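(* Let $A$ and $B$ be diassociative algebras over a field $\mathbb{F}$. Given an extension $0\to A\xrightarrow{\sigma}L\xrightarrow{\pi}B\to0$ of $A$ by $B$ and a section $T:B\to L$, there exists a unique factor system $(\varphi_{\dashv},\varphi_{\vdash},\varphi_{\dashv}',\varphi_{\vdash}',f_{\dashv},f_{\vdash})$ of $A$ by $B$ belonging to the extension and $T$.
   Context: All algebras are vector spaces over a fixed field $\mathbb{F}$. A diassociative algebra is a vector space with two associative bilinear products $\dashv,\vdash$ satisfying, for all $x,y,z$: (D1) $x\dashv(y\dashv z)=x\dashv(y\vdash z)$; (D2) $(x\vdash y)\dashv z=x\vdash(y\dashv z)$; (D3) $(x\dashv y)\vdash z=(x\vdash y)\vdash z$. Homomorphisms are linear maps preserving both products. $\mathcal{L}(A)$ is the space of linear maps $A\to A$. A factor system of $A$ by $B$ is a tuple $(\varphi_{\dashv},\varphi_{\vdash},\varphi_{\dashv}',\varphi_{\vdash}',f_{\dashv},f_{\vdash})$ with $\varphi_{\dashv},\varphi_{\vdash},\varphi_{\dashv}',\varphi_{\vdash}':B\to\mathcal{L}(A)$ linear and $f_{\dashv},f_{\vdash}:B\times B\to A$ bilinear such that for all $m,n,p\in A$, $i,j,k\in B$: 1. (a) $m\dashv(\varphi_{\dashv}(j)p)=m\dashv(\varphi_{\vdash}(j)p)$; (b) $m\dashv(\varphi_{\dashv}'(k)n)=m\dashv(\varphi_{\vdash}'(k)n)$; (c) $m\dashv f_{\dashv}(j,k)+\varphi_{\dashv}'(j\dashv k)m=m\dashv f_{\vdash}(j,k)+\varphi_{\dashv}'(j\vdash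 k)m$; (d) $\varphi_{\dashv}(i)(n\dashv p)=\varphi_{\dashv}(i)(n\vdash p)$; (e) $\varphi_{\dashv}(i)(\varphi_{\dashv}(j)p)=\varphi_{\dashv}(i)(\varphi_{\vdash}(j)p)$; (f) $\varphi_{\dashv}(i)(\varphi_{\dashv}'(k)n)=\varphi_{\dashv}(i)(\varphi_{\vdash}'(k)n)$; (g) $\varphi_{\dashv}(i)f_{\dashv}(j,k)+f_{\dashv}(i,j\dashv k)=\varphi_{\dashv}(i)f_{\vdash}(j,k)+f_{\dashv}(i,j\vdash k)$. 2. (a) $(\varphi_{\vdash}(i)n)\dashv p=\varphi_{\vdash}(i)(n\dashv p)$; (b) $(\varphi_{\vdash}'(j)m)\dashv p=m\vdash(\varphi_{\dashv}(j)p)$; (c) $f_{\vdash}(i,j)\dashv p+\varphi_{\dashv}(i\vdash j)p=\varphi_{\vdash}(i)(\varphi_{\dashv}(j)p)$; (d) $\varphi_{\dashv}'(k)(m\vdash n)=m\vdash(\varphi_{\dashv}'(k)n)$; (e) $\varphi_{\dashv}'(k)(\varphi_{\vdash}(i)n)=\varphi_{\vdash}(i)(\varphi_{\dashv}'(k)n)$; (f) $\varphi_{\dashv}'(k)(\varphi_{\vdash}'(j)m)=\varphi_{\vdash}'(j\dashv k)m+m\vdash f_{\dashv}(j,k)$; (g) $\varphi_{\dashv}'(k)f_{\vdash}(i,j)+f_{\dashv}(i\vdash j,k)=\varphi_{\vdash}(i)f_{\dashv}(j,k)+f_{\vdash}(i,j\dashv k)$. 3. (a) $(\varphi_{\dashv}(i)n)\vdash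 p=(\varphi_{\vdash}(i)n)\vdash p$; (b) $(\varphi_{\dashv}'(j)m)\vdash p=(\varphi_{\vdash}'(j)m)\vdash p$; (c) $f_{\dashv}(i,j)\vdash p+\varphi_{\vdash}(i\dashv j)p=f_{\vdash}(i,j)\vdash p+\varphi_{\vdash}(i\vdash j)p$; (d) $\varphi_{\vdash}'(k)(m\dashv n)=\varphi_{\vdash}'(k)(m\vdash n)$; (e) $\varphi_{\vdash}'(k)(\varphi_{\dashv}(i)n)=\varphi_{\vdash}'(k)(\varphi_{\vdash}(i)n)$; (f) $\varphi_{\vdash}'(k)(\varphi_{\dashv}'(j)m)=\varphi_{\vdash}'(k)(\varphi_{\vdash}'(j)m)$; (g) $\varphi_{\vdash}'(k)f_{\dashv}(i,j)+f_{\vdash}(i\dashv j,k)=\varphi_{\vdash}'(k)f_{\vdash}(i,j)+f_{\vdash}(i\vdash j,k)$. 4. (a) $m\dashv(\varphi_{\dashv}(j)p)=(\varphi_{\dashv}'(j)m)\dashv p$; (b) $m\dashv(\varphi_{\dashv}'(k)n)=\varphi_{\dashv}'(k)(m\dashv n)$; (c) $m\dashv f_{\dashv}(j,k)+\varphi_{\dashv}'(j\dashv k)m=\varphi_{\dashv}'(k)(\varphi_{\dashv}'(j)m)$; (d) $\varphi_{\dashv}(i)(n\dashv p)=(\varphi_{\dashv}(i)n)\dashv p$; (e) $\varphi_{\dashv}(i)(\varphi_{\dashv}(j)p)=\varphi_{\dashv}(i\dashv j)p+f_{\dashv}(i,j)\dashv p$; (f) $\varphi_{\dashv}(i)(\varphi_{\dashv}'(k)n)=\varphi_{\dashv}'(k)(\varphi_{\dashv}(i)n)$;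 (g) $\varphi_{\dashv}(i)f_{\dashv}(j,k)+f_{\dashv}(i,j\dashv k)=\varphi_{\dashv}'(k)f_{\dashv}(i,j)+f_{\dashv}(i\dashv j,k)$. 5. The identities obtained from 4(a)–(g) by replacing every $\dashv$ (including in subscripts) by $\vdash$. An extension of $A$ by $B$ is a short exact sequence $0\to A\xrightarrow{\sigma}L\xrightarrow{\pi}B\to0$ with $L$ a diassociative algebra and $\sigma,\pi$ homomorphisms. A section is a linear map $T:B\to L$ with $\pi T=I_B$. For $x\in L$, $m\in A$ put $P_{\dashv}(x)m=\sigma^{-1}(x\dashv\sigma(m))$, $P_{\dashv}'(x)m=\sigma^{-1}(\sigma(m)\dashv x)$, $P_{\vdash}(x)m=\sigma^{-1}(x\vdash\sigma(m))$, $P_{\vdash}'(x)m=\sigma^{-1}(\sigma(m)\vdash x)$. A factor system belongs to the extension and $T$ if $\varphi_{\dashv}=P_{\dashv}T$, $\varphi_{\vdash}=P_{\vdash}T$, $\varphi_{\dashv}'=P_{\dashv}'T$, $\varphi_{\vdash}'=P_{\vdash}'T$, $\sigma(f_{\dashv}(i,j))=T(i)\dashv T(j)-T(i\dashv j)$ and $\sigma(f_{\vdash}(i,j))=T(i)\vdash T(j)-T(i\vdash j)$ for all $i,j\in B$. *)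

(* Defs.v *)
From HB Require Import structures.
From mathcomp Require Import all_boot all_algebra.
From mathcomp Require Import boolp classical_sets functions.

Set Implicit Arguments.
Unset Strict Implicit.
Unset Printing Implicit Defensive.
Import GRing.Theory.

Local Open Scope ring_scope.
Local Open Scope classical_set_scope.

HB.mixin Record Lmodule_isDiassociative (F : fieldType) V
    of GRing.Lmodule F V := {
  dil : V -> V -> V;
  dir : V -> V -> V;
  dil_bilinear : bilinear_for *:%R *:%R dil;
  dir_bilinear : bilinear_for *:%R *:%R dir;
  dilA : associative dil;
  dirA : associative dir;
  diassocD1 : forall x y z, dil x (dil y z) = dil x (dir y z);
  diassocD2 : forall x y z, dil (dir x y) z = dir x (dil y z);
  diassocD3 : forall x y z, dir (dil x y) z = dir (dir x y) z
}.

#[short(type="diassocType")]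
HB.structure Definition Diassociative (F : fieldType) :=
  {V of Lmodule_isDiassociative F V & GRing.Lmodule F V}.

Notation "x ⊣ y" := (dil x y) (at level 40, left associativity) : ring_scope.
Notation "x ⊢ y" := (dir x y) (at level 40, left associativity) : ring_scope.

HB.instance Definition _ (F : fieldType) (A : diassocType F) :=
  bilinear_isBilinear.Build F A A A *:%R *:%R (@dil F A) dil_bilinear.
HB.instance Definition _ (F : fieldType) (A : diassocType F) :=
  bilinear_isBilinear.Build F A A A *:%R *:%R (@dir F A) dir_bilinear.

Definition dimorphism (F : fieldType) (A B : diassocType F)
    (h : {linear A -> B}) : Prop :=
  {morph h : x y / x ⊣ y} /\ {morph h : x y / x ⊢ y}.

(* Suffix l stands for ⊣ and r for ⊢. *)
Record factor_data (F : fieldType) (A B : diassocType F) := FactorData {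
  phil : B -> {linear A -> A};
  phir : B -> {linear A -> A};
  phil' : B -> {linear A -> A};
  phir' : B -> {linear A -> A};
  fl : {bilinear B -> B -> A};
  fr : {bilinear B -> B -> A}
}.

(* The identities attached to the associativity of a single product; A and B
   carry the products opA and opB. *)
Record assoc_identities (F : fieldType) (A B : diassocType F)
    (opA : A -> A -> A) (opB : B -> B -> B)
    (phi phi' : B -> {linear A -> A}) (f : {bilinear B -> B -> A}) : Prop := {
  assoc_a : forall j m p, opA m (phi j p) = opA (phi' j m) p;
  assoc_b : forall k m n, opA m (phi' k n) = phi' k (opA m n);
  assoc_c : forall j k m,
    opA m (f j k) + phi' (opB j k) m = phi' k (phi' j m);
  assoc_d : forall i n p, phi i (opA n p) = opA (phi i n) p;
  assoc_e : forall i j p,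
    phi i (phi j p) = phi (opB i j) p + opA (f i j) p;
  assoc_f : forall i k n, phi i (phi' k n) = phi' k (phi i n);
  assoc_g : forall i j k,
    phi i (f j k) + f i (opB j k) = phi' k (f i j) + f (opB i j) k
}.

(* The linearity conditions are in the lmodType of functions A -> A, whose
   operations are those of L(A). *)
Record is_factor_system (F : fieldType) (A B : diassocType F)
    (fs : factor_data A B) : Prop := {
  phil_linear : linear (fun i => phil fs i : A -> A);
  phir_linear : linear (fun i => phir fs i : A -> A);
  phil'_linear : linear (fun i => phil' fs i : A -> A);
  phir'_linear : linear (fun i => phir' fs i : A -> A);

  fs1a : forall j m p, m ⊣ phil fs j p = m ⊣ phir fs j p;
  fs1b : forall k m n, m ⊣ phil' fs k n = m ⊣ phir' fs k n;
  fs1c : forall j k m,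
    m ⊣ fl fs j k + phil' fs (j ⊣ k) m = m ⊣ fr fs j k + phil' fs (j ⊢ k) m;
  fs1d : forall i n p, phil fs i (n ⊣ p) = phil fs i (n ⊢ p);
  fs1e : forall i j p, phil fs i (phil fs j p) = phil fs i (phir fs j p);
  fs1f : forall i k n, phil fs i (phil' fs k n) = phil fs i (phir' fs k n);
  fs1g : forall i j k,
    phil fs i (fl fs j k) + fl fs i (j ⊣ k)
    = phil fs i (fr fs j k) + fl fs i (j ⊢ k);

  fs2a : forall i n p, phir fs i n ⊣ p = phir fs i (n ⊣ p);
  fs2b : forall j m p, phir' fs j m ⊣ p = m ⊢ phil fs j p;
  fs2c : forall i j p,
    fr fs i j ⊣ p + phil fs (i ⊢ j) p = phir fs i (phil fs j p);
  fs2d : forall k m n, phil' fs k (m ⊢ n) = m ⊢ phil' fs k n;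
  fs2e : forall i k n, phil' fs k (phir fs i n) = phir fs i (phil' fs k n);
  fs2f : forall j k m,
    phil' fs k (phir' fs j m) = phir' fs (j ⊣ k) m + m ⊢ fl fs j k;
  fs2g : forall i j k,
    phil' fs k (fr fs i j) + fl fs (i ⊢ j) k
    = phir fs i (fl fs j k) + fr fs i (j ⊣ k);

  fs3a : forall i n p, phil fs i n ⊢ p = phir fs i n ⊢ p;
  fs3b : forall j m p, phil' fs j m ⊢ p = phir' fs j m ⊢ p;
  fs3c : forall i j p,
    fl fs i j ⊢ p + phir fs (i ⊣ j) p = fr fs i j ⊢ p + phir fs (i ⊢ j) p;
  fs3d : forall k m n, phir' fs k (m ⊣ n) = phir' fs k (m ⊢ n);
  fs3e : forall i k n, phir' fs k (phil fs i n) = phir' fs k (phir fs i n);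
  fs3f : forall j k m, phir' fs k (phil' fs j m) = phir' fs k (phir' fs j m);
  fs3g : forall i j k,
    phir' fs k (fl fs i j) + fr fs (i ⊣ j) k
    = phir' fs k (fr fs i j) + fr fs (i ⊢ j) k;

  fs4 : assoc_identities (@dil F A) (@dil F B) (phil fs) (phil' fs) (fl fs);
  fs5 : assoc_identities (@dir F A) (@dir F B) (phir fs) (phir' fs) (fr fs)
}.

Record is_extension (F : fieldType) (A L B : diassocType F)
    (sigma : {linear A -> L}) (pi : {linear L -> B}) : Prop := {
  ext_sigma_morph : dimorphism sigma;
  ext_pi_morph : dimorphism pi;
  ext_sigma_inj : injective sigma;
  ext_exact : range sigma = pi @^-1` [set 0];
  ext_pi_surj : range pi = [set: B]
}.

(* In an extension the argument of the inverse image is always in the range of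
   sigma (an ideal), so the default value 0 of the partial inverse is not used. *)
Section Multipliers.
Variables (F : fieldType) (A L : diassocType F) (sigma : {linear A -> L}).

Definition sigma_inv : L -> A := 'pinv_(fun=> 0) [set: A] sigma.

Definition Pl (x : L) (m : A) : A := sigma_inv (x ⊣ sigma m).
Definition Pl' (x : L) (m : A) : A := sigma_inv (sigma m ⊣ x).
Definition Pr (x : L) (m : A) : A := sigma_inv (x ⊢ sigma m).
Definition Pr' (x : L) (m : A) : A := sigma_inv (sigma m ⊢ x).
End Multipliers.

Record belongs_to (F : fieldType) (A L B : diassocType F)
    (sigma : {linear A -> L}) (T : {linear B -> L})
    (fs : factor_data A B) : Prop := {
  phil_belongs : forall i, phil fs i =1 Pl sigma (T i);
  phir_belongs : forall i, phir fs i =1 Pr sigma (T i);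
  phil'_belongs : forall i, phil' fs i =1 Pl' sigma (T i);
  phir'_belongs : forall i, phir' fs i =1 Pr' sigma (T i);
  fl_belongs : forall i j, sigma (fl fs i j) = T i ⊣ T j - T (i ⊣ j);
  fr_belongs : forall i j, sigma (fr fs i j) = T i ⊢ T j - T (i ⊢ j)
}.

(* Main.v *)
From HB Require Import structures.
Require Import Defs.
From mathcomp Require Import all_boot all_algebra.
From mathcomp Require Import boolp classical_sets functions.
Import GRing.Theory.

Set Implicit Arguments.
Unset Strict Implicit.
Unset Printing Implicit Defensive.

Local Open Scope ring_scope.

(** The image of sigma is the kernel of pi and sigma is injective, so every map
    into L that pi kills lifts uniquely through sigma.  The products
    T(i) * sigma(m) and sigma(m) * T(i), and the defect T(i) * T(j) - T(i * j),
    are all killed by pi, because pi is a homomorphism and T is a section; their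
    lifts are the six components of the factor system ([realizers_exist]).

    Each identity of a factor system then holds because its image under sigma is
    one of the axioms (associativity, D1, D2, D3) of L evaluated at three
    elements, each of which is some sigma(m) or some T(i).  At three elements
    T(i), T(j), T(k) each side has one further term, - T(i * (j * k)) or
    - T((i * j) * k) with the products of that side, and these agree by the same
    axiom in B.

    For uniqueness, the conditions of belonging to T give the values of each
    component, directly or through the injective map sigma, and linear or
    bilinear maps with the same values are equal. *)

(** * Extensionality of bundled maps *)

Lemma linear_ext (R : pzRingType) (U V : lmodType R) (g h : {linear U -> V}) :
  g =1 h -> g = h.
Proof.
case: g h => [g [[ga] [gs]]] [h [[ha] [hs]]] /= /funext gh.
by case: _ / gh in ha hs *; rewrite (Prop_irrelevance ga ha)
  (Prop_irrelevance gs hs).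
Qed.

Lemma bilinear_ext (R : nzRingType) (U V W : lmodType R)
    (g h : {bilinear U -> V -> W}) :
  (forall x y, g x y = h x y) -> g = h.
Proof.
case: g h => [g [[g1 g2 g3 g4]]] [h [[h1 h2 h3 h4]]] /= gh0.
have gh : g = h by apply/funext => x; apply/funext => y; exact: gh0.
case: _ / gh in h1 h2 h3 h4 *.
by rewrite (Prop_irrelevance g1 h1) (Prop_irrelevance g2 h2)
  (Prop_irrelevance g3 h3) (Prop_irrelevance g4 h4).
Qed.

(** * Lifting through the kernel *)

Section Lift.
Variables (F : fieldType) (A L B : lmodType F).
Variables (sigma : {linear A -> L}) (pi : {linear L -> B}).
Hypothesis sigma_inj : injective sigma.
Hypothesis ker_pi : forall y, pi y = 0 -> exists m, sigma m = y.

(** A preimage chosen for each value is already linear, because sigma is linear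
    and injective; a family is lifted at once so that the choice over the index
    is made here too. *)
Lemma lift_linear_family (I : Type) (V : lmodType F) (g : I -> V -> L) :
    (forall i, linear (g i)) -> (forall i v, pi (g i v) = 0) ->
  exists h : I -> {linear V -> A}, forall i v, sigma (h i v) = g i v.
Proof.
move=> g_lin g0.
suff /choice[h hE] : forall i, exists h : {linear V -> A},
    forall v, sigma (h v) = g i v by exists h.
move=> i; have [h hE] := choice (fun v => ker_pi (g0 i v)).
have h_lin : linear h.
  by move=> a u v; apply: sigma_inj; rewrite linearP !hE g_lin.
pose H := GRing.isLinear.Build F V A _ h h_lin.
pose h' : {linear V -> A} := HB.pack h H.
by exists h'.
Qed.

Lemma lift_bilinear (U V : lmodType F) (g : U -> V -> L) :
    bilinear_for *:%R *:%R g -> (forall u v, pi (g u v) = 0) ->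
  exists h : {bilinear U -> V -> A}, forall u v, sigma (h u v) = g u v.
Proof.
move=> [g_linl g_linr] g0.
have [h hE] := choice (fun uv => ker_pi (g0 uv.1 uv.2)).
have h_lin : bilinear_for *:%R *:%R (fun u v => h (u, v)).
  split=> [v a x y|u a x y] /=; apply: sigma_inj;
    by rewrite linearP !hE /= (g_linl, g_linr).
pose H := bilinear_isBilinear.Build F U V A *:%R *:%R _ h_lin.
pose h' : {bilinear U -> V -> A} := HB.pack (fun u v => h (u, v)) H.
by exists h' => u v; rewrite [LHS]hE.
Qed.

End Lift.

(** * The identities of a single product *)

Section OneProduct.
Variables (F : fieldType) (A L B : diassocType F).
Variables (sigma : {linear A -> L}) (pi : {linear L -> B}).
Variable T : {linear B -> L}.
Variables (opA : A -> A -> A) (opL : {bilinear L -> L -> L}).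
Variable opB : {bilinear B -> B -> B}.

(** The conditions of belonging to T for one product, stated in L through sigma
    rather than in A through its partial inverse: in this form an identity of A
    can be read as an axiom of L. *)
Record realizes (phi phi' : B -> {linear A -> A})
    (f : {bilinear B -> B -> A}) : Prop := {
  realizes_phi : forall i m, sigma (phi i m) = opL (T i) (sigma m);
  realizes_phi' : forall i m, sigma (phi' i m) = opL (sigma m) (T i);
  realizes_f : forall i j, sigma (f i j) = opL (T i) (T j) - T (opB i j)
}.

Hypothesis sigma_inj : injective sigma.

Lemma realizers_exist :
    (forall m, pi (sigma m) = 0) ->
    (forall y, pi y = 0 -> exists m, sigma m = y) ->
    {morph pi : x y / opL x y >-> opB x y} -> cancel T pi ->
  exists phi phi' f, realizes phi phi' f.
Proof.
move=> pi_sigma ker_pi piM piT.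
have [|i m|phi phiE] := lift_linear_family sigma_inj ker_pi
    (g := fun i m => opL (T i) (sigma m)).
- by move=> i a u v /=; rewrite !linearP.
- by rewrite piM pi_sigma linear0r.
have [|i m|phi' phi'E] := lift_linear_family sigma_inj ker_pi
    (g := fun i m => opL (sigma m) (T i)).
- by move=> i a u v /=; rewrite linearP linearPl.
- by rewrite piM pi_sigma linear0l.
have [|i j|f fE] := lift_bilinear sigma_inj ker_pi
    (g := fun i j => opL (T i) (T j) - T (opB i j)).
- by split=> u a x y /=; rewrite ?linearPl !linearP /= ?linearPl ?linearP
    addrACA -scalerDr.
- by rewrite linearB /= piM !piT subrr.
by exists phi, phi', f.
Qed.

Variables (phi phi' : B -> {linear A -> A}) (f : {bilinear B -> B -> A}).
Hypothesis hf : realizes phi phi' f.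

Let realizesE := (realizes_phi hf, realizes_phi' hf, realizes_f hf).

Lemma realizes_linear :
  linear (fun i => phi i : A -> A) /\ linear (fun i => phi' i : A -> A).
Proof.
by split=> a i j; apply/funext => m; apply: sigma_inj;
  rewrite [RHS]linearP !realizesE linearP (linearPl, linearPr).
Qed.

(** Under sigma the seven identities are associativity of L at the seven kinds
    of triples of elements sigma(m) or T(i) that are not all of the form
    sigma(m).  In (c), (e) and (g) the terms T(i * j) subtracted in f
    cancel against those added by phi, phi' or f; in (g) associativity of B
    identifies the remaining terms T(i * (j * k)) and T((i * j) * k). *)
Lemma realizes_assoc_identities :
    {morph sigma : x y / opA x y >-> opL x y} ->
    associative opL -> associative opB ->
  assoc_identities opA opB phi phi' f.
Proof.
move=> sigmaM opLA opBA.
split=> *; apply: sigma_inj; rewrite ?linearD /= ?(sigmaM, realizesE).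
- exact: opLA.
- exact: opLA.
- by rewrite linearBr subrK opLA.
- exact: opLA.
- by rewrite linearBl addrC subrK opLA.
- exact: opLA.
- by rewrite linearBr linearBl !addrA !subrK opLA opBA.
Qed.

End OneProduct.

(** * Factor systems of an extension *)

Lemma ext_pi_sigma (F : fieldType) (A L B : diassocType F)
    (sigma : {linear A -> L}) (pi : {linear L -> B}) :
  is_extension sigma pi -> forall m, pi (sigma m) = 0.
Proof.
move=> hE m; have : range sigma (sigma m) by exists m.
by rewrite (ext_exact hE).
Qed.

Lemma ext_ker_pi (F : fieldType) (A L B : diassocType F)
    (sigma : {linear A -> L}) (pi : {linear L -> B}) :
  is_extension sigma pi -> forall y, pi y = 0 -> exists m, sigma m = y.
Proof.
move=> hE y y0; have : range sigma y by rewrite (ext_exact hE).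
by case=> m _ <-; exists m.
Qed.

Lemma sigma_invK (F : fieldType) (A L : diassocType F)
    (sigma : {linear A -> L}) :
  injective sigma -> cancel sigma (sigma_inv sigma).
Proof. by move=> inj m; apply: pinvKV; rewrite ?inE // => x y _ _ /inj. Qed.

(** D1, D2 and D3 relate the two products, so identities 1 to 3 need both triples
    of components at once; the proof is again evaluation of each axiom of L at
    elements sigma(m) or T(i), after which the terms T(i * j) cancel. *)
Lemma realizes_is_factor_system (F : fieldType) (A L B : diassocType F)
    (sigma : {linear A -> L}) (T : {linear B -> L}) (fs : factor_data A B) :
    injective sigma -> dimorphism sigma ->
    realizes sigma T (@dil F L) (@dil F B) (phil fs) (phil' fs) (fl fs) ->
    realizes sigma T (@dir F L) (@dir F B) (phir fs) (phir' fs) (fr fs) ->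
  is_factor_system fs.
Proof.
move=> sigma_inj [sigmaMl sigmaMr] hl hr.
have [phil_lin phil'_lin] := realizes_linear sigma_inj hl.
have [phir_lin phir'_lin] := realizes_linear sigma_inj hr.
have lE := (realizes_phi hl, realizes_phi' hl, realizes_f hl).
have rE := (realizes_phi hr, realizes_phi' hr, realizes_f hr).
have assocl := realizes_assoc_identities sigma_inj hl sigmaMl
  (@dilA F L) (@dilA F B).
have assocr := realizes_assoc_identities sigma_inj hr sigmaMr
  (@dirA F L) (@dirA F B).
split=> // *; apply: sigma_inj; rewrite ?linearD /= ?(sigmaMl, sigmaMr, lE, rE)
  /= ?(linearBr, linearBl) /= ?addrA ?subrK
  ?(diassocD1, diassocD2, diassocD3) //.
(* What remains is the identity for sigma(m), T(j), T(k), where the value of f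
   is the second summand. *)
by rewrite [RHS]addrC addKr.
Qed.

Lemma belongs_to_inj (F : fieldType) (A L B : diassocType F)
    (sigma : {linear A -> L}) (T : {linear B -> L}) (fs gs : factor_data A B) :
    injective sigma ->
  belongs_to sigma T fs -> belongs_to sigma T gs -> fs = gs.
Proof.
move=> inj; case: fs gs => [p1 p2 p3 p4 f1 f2] [q1 q2 q3 q4 g1 g2].
case=> /= p1E p2E p3E p4E f1E f2E [/= q1E q2E q3E q4E g1E g2E].
congr FactorData; try by apply/funext => i; apply: linear_ext => m;
  rewrite (p1E, p2E, p3E, p4E) (q1E, q2E, q3E, q4E).
- by apply: bilinear_ext => i j; apply: inj; rewrite f1E g1E.
- by apply: bilinear_ext => i j; apply: inj; rewrite f2E g2E.
Qed.

Theorem theorem4p1 (F : fieldType) (A L B : diassocType F)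
    (sigma : {linear A -> L}) (pi : {linear L -> B})
    (hE : is_extension sigma pi) (T : {linear B -> L}) (hT : cancel T pi) :
  exists! fs : factor_data A B, is_factor_system fs /\ belongs_to sigma T fs.
Proof.
have inj := ext_sigma_inj hE; have [piMl piMr] := ext_pi_morph hE.
have [pl [pl' [f hl]]] := realizers_exist inj (ext_pi_sigma hE) (ext_ker_pi hE)
  piMl hT.
have [pr [pr' [g hr]]] := realizers_exist inj (ext_pi_sigma hE) (ext_ker_pi hE)
  piMr hT.
pose fs := FactorData pl pr pl' pr' f g.
have fs_sys : is_factor_system fs.
  exact: (realizes_is_factor_system (fs := fs) inj (ext_sigma_morph hE) hl hr).
have fs_belongs : belongs_to sigma T fs.
  have sK := sigma_invK inj.
  split=> [i m|i m|i m|i m|i j|i j] /=.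
  - by rewrite -[LHS]sK (realizes_phi hl).
  - by rewrite -[LHS]sK (realizes_phi hr).
  - by rewrite -[LHS]sK (realizes_phi' hl).
  - by rewrite -[LHS]sK (realizes_phi' hr).
  - exact: (realizes_f hl).
  - exact: (realizes_f hr).
exists fs; split=> // gs [_ gs_belongs].
exact: belongs_to_inj inj fs_belongs gs_belongs.
Qed.
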